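(* The class of measure zero ultrafilters on $\omega$ is closed under measure zero ultrafilter sums: if $u$ and $v_n$ ($n<\omega$) are measure zero ultrafilters on $\omega$, then $\sum_u\langle v_n:n<\omega\rangle$ is a measure zero ultrafilter.
   Context: An ultrafilter $u$ on $\omega$ is a measure zero ultrafilter if for every $F:\omega\to{}^\omega2$ there is $A\in u$ such that the closure $\overline{F(A)}$ in ${}^\omega 2$ has measure zero (with respect to the standard product probability measure on ${}^\omega2$). If $u$ and $v_n$ ($n<\omega$) are ultrafilters on $\omega$, then $\sum_u\langle v_n:n<\omega\rangle$ is the ultrafilter on $\omega\times\omega$ consisting of all $Z\subseteq\omega\times\omega$ with $\{n:\{m:(n,m)\in Z\}\in v_n\}\in u$; it is regarded as an ultrafilter on $\omega$ via a bijection $\omega\times\omega\to\omega$ (isomorphic ultrafilters are identified). *)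

(* Defs.v *)
From HB Require Import structures.
From mathcomp Require Import all_boot all_order all_algebra finmap.
From mathcomp Require Import all_classical all_reals all_analysis.

Set Implicit Arguments.
Unset Strict Implicit.
Unset Printing Implicit Defensive.
Import Order.TTheory GRing.Theory Num.Theory.
Import numFieldNormedType.Exports.

Local Open Scope classical_set_scope.
Local Open Scope ring_scope.

(* [determined n A]: membership in [A] depends on the first [n] coordinates
   only; the sets determined by finitely many coordinates form an algebra,
   which generates the product sigma-algebra on the Cantor space. *)
Definition determined (n : nat) (A : set cantor_space) : Prop :=
  forall x y : cantor_space,
    (forall i, (i < n)%N -> x i = y i) -> A x -> A y.

Definition finitely_determined : set_system cantor_space :=
  [set A | exists n, determined n A].

Lemma determinedC n A : determined n A -> determined n (~` A).
Proof. by move=> dA x y xy nAx Ay; apply: nAx; apply: dA Ay => i /xy. Qed.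

Lemma determined_le m n A : (m <= n)%N -> determined m A -> determined n A.
Proof.
by move=> mn dA x y xy; apply: dA => i im; apply: xy; exact: leq_trans mn.
Qed.

Lemma determinedU n A B :
  determined n A -> determined n B -> determined n (A `|` B).
Proof.
by move=> dA dB x y xy [Ax|Bx]; [left; apply: dA Ax|right; apply: dB Bx].
Qed.

Lemma finitely_determined0 : finitely_determined set0.
Proof. by exists 0%N. Qed.

Lemma finitely_determinedU : setU_closed finitely_determined.
Proof.
move=> A B [m dA] [n dB]; exists (maxn m n); apply: determinedU.
  exact: determined_le (leq_maxl _ _) dA.
exact: determined_le (leq_maxr _ _) dB.
Qed.

Lemma finitely_determinedC : setC_closed finitely_determined.
Proof. by move=> A [n dA]; exists n; exact: determinedC. Qed.

Definition cylinder_type : Type := cantor_space.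
HB.instance Definition _ := Pointed.on cylinder_type.

Definition cylinder_display : measure_display.
Proof. exact. Qed.

HB.instance Definition _ := @isAlgebraOfSets.Build cylinder_display
  cylinder_type finitely_determined finitely_determined0 finitely_determinedU
  finitely_determinedC.

Definition ccons (b : bool) (x : cantor_space) : cantor_space :=
  fun i => if i is j.+1 then x j else b.

Lemma determined_ccons n b A :
  determined n.+1 A -> determined n (ccons b @^-1` A).
Proof. by move=> dA x y xy; apply: dA => -[|i]//= /xy. Qed.

Section fair_coin_content.
Context (R : realType).

(* The proportion, among the [2 ^ n] binary words of length [n], of those
   whose extension by zeros lies in [A]. *)
Fixpoint word_ratio (n : nat) (A : set cantor_space) : R :=
  if n is m.+1 then
    (word_ratio m (ccons false @^-1` A) + word_ratio m (ccons true @^-1` A)) / 2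
  else if `[< A (fun=> false) >] then 1 else 0.

Lemma word_ratio_ge0 n A : 0 <= word_ratio n A.
Proof.
elim: n A => [|n IHn] A /=; first by case: ifP.
by rewrite divr_ge0// addr_ge0.
Qed.

Lemma word_ratioU n A B : A `&` B = set0 ->
  word_ratio n (A `|` B) = word_ratio n A + word_ratio n B.
Proof.
elim: n A B => [|n IHn] A B AB /=.
  case: asboolP => [[] P|P]; (do 2 case: asboolP => ?) => //;
    rewrite ?addr0 ?add0r//; try by exfalso; tauto.
  - have : (A `&` B) (fun=> false) by [].
    by rewrite AB.
  - have : (A `&` B) (fun=> false) by [].
    by rewrite AB.
have cAB b : ccons b @^-1` A `&` ccons b @^-1` B = set0.
  by rewrite -preimage_setI AB preimage_set0.
by rewrite !preimage_setU (IHn _ _ (cAB false)) (IHn _ _ (cAB true)) addrACA mulrDl.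
Qed.

Lemma word_ratioS n A : determined n A -> word_ratio n.+1 A = word_ratio n A.
Proof.
elim: n A => [|n IHn] A dA; last first.
  have dc b := IHn _ (@determined_ccons n b A dA).
  by rewrite -[LHS]/((word_ratio n.+1 _ + word_ratio n.+1 _) / 2) !dc.
have E x : A x = A (fun=> false) by apply/propext; split; exact: dA.
rewrite /= (E (ccons false _)) (E (ccons true _)).
by case: ifP => _; rewrite ?addr0 ?mul0r// divff.
Qed.

Lemma word_ratioE m n A : determined m A -> determined n A ->
  word_ratio m A = word_ratio n A.
Proof.
have H p q : determined p A -> (p <= q)%N -> word_ratio q A = word_ratio p A.
  move=> dA; elim: q => [|q IHq]; first by rewrite leqn0 => /eqP ->.
  rewrite leq_eqVlt => /predU1P[->//|]; rewrite ltnS => pq.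
  by rewrite word_ratioS ?IHq//; exact: determined_le pq dA.
by move=> dm dn; case: (leqP m n) => [mn|/ltnW nm]; [rewrite (H m n)|rewrite (H n m)].
Qed.

Definition fair_coin_content (A : set cylinder_type) : \bar R :=
  if pselect (finitely_determined A) is left dA
  then (word_ratio (projT1 (cid dA)) A)%:E else 0%E.

Lemma fair_coin_contentE n A :
  determined n A -> fair_coin_content A = (word_ratio n A)%:E.
Proof.
move=> dA; rewrite /fair_coin_content; case: pselect => [dA'|]; last first.
  by case; exists n.
by congr EFin; apply: word_ratioE => //; case: cid.
Qed.

Lemma fair_coin_content_ge0 A : (0 <= fair_coin_content A)%E.
Proof.
rewrite /fair_coin_content; case: pselect => // ?.
by rewrite lee_fin word_ratio_ge0.
Qed.

Lemma fair_coin_content_additive2 : measure_function.semi_additive2 fair_coin_content.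
Proof.
move=> A B [m dA] [n dB] _ AB.
have {}dA := determined_le (leq_maxl m n) dA.
have {}dB := determined_le (leq_maxr m n) dB.
rewrite (fair_coin_contentE dA) (fair_coin_contentE dB).
by rewrite (fair_coin_contentE (determinedU dA dB)) word_ratioU.
Qed.

Lemma fair_coin_content0 : fair_coin_content set0 = 0%E.
Proof.
rewrite (@fair_coin_contentE 0%N)// /word_ratio /=.
by case: asboolP.
Qed.

Lemma fair_coin_content_additive : measure_function.semi_additive fair_coin_content.
Proof.
apply/(additive2P fair_coin_content0).
by rewrite -semi_additive2E; exact: fair_coin_content_additive2.
Qed.

HB.instance Definition _ := isContent.Build _ _ R
  fair_coin_content fair_coin_content_ge0 fair_coin_content_additive.

End fair_coin_content.

Lemma near_agree (x : cantor_space) n :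
  \forall y \near x, forall i, (i < n)%N -> x i = y i.
Proof.
elim: n => [|n IHn]; first by apply: (@filterE _ (nbhs x) (nbhs_filter x)) => y i.
have xn : nbhs x [set y : cantor_space | x n = y n].
  have /(_ [set b | x n = b]) := @proj_continuous nat (fun=> bool) n x.
  move=> /(_ _)H; apply: H.
  by apply: (@filterS bool (nbhs (x n)) _ [set x n]) => [b /= ->|]; last exact: discrete_set1.
apply: (@filterS _ (nbhs x) (nbhs_filter x) _ _ _
  (@filterI _ (nbhs x) (nbhs_filter x) _ _ IHn xn)).
by move=> y [xy /= xyn] i; rewrite ltnS leq_eqVlt => /predU1P[->|/xy].
Qed.

Lemma finitely_determined_open A : finitely_determined A -> open A.
Proof.
move=> [n dA]; rewrite openE => x Ax.
apply: (@filterS _ (nbhs x) (nbhs_filter x) _ _ _ (near_agree x n)) => y xy.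
exact: dA Ax.
Qed.

Lemma finitely_determined_compact A : finitely_determined A -> compact A.
Proof.
move=> dA; apply: (@subclosed_compact _ A setT) => //.
  rewrite -[A]setCK; apply: open_closedC; apply: finitely_determined_open.
  exact: finitely_determinedC.
exact: cantor_space_compact.
Qed.

Section cantor_measure.
Context (R : realType).

Lemma fair_coin_content_sigma_subadditive :
  measurable_subset_sigma_subadditive (@fair_coin_content R).
Proof.
move=> A F mF mA AF.
have := finitely_determined_compact mA; rewrite compact_cover.
move=> /(_ nat setT F)[i _||X _ XA].
- exact/finitely_determined_open/mF.
- exact: AF.
have XA' : A `<=` \bigcup_(i in [set` X]) F i by [].
apply: (@le_trans _ _ (\sum_(i \in [set` X]) fair_coin_content R (F i))%E).
  exact: (@content_sub_fsum _ _ _ (@fair_coin_content R)).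
rewrite nneseries_esum//.
by rewrite esum_ge//; exists [set` X] => //; rewrite set_fsetK.
Qed.

HB.instance Definition _ := Content_SigmaSubAdditive_isMeasure.Build _ _ _
  (@fair_coin_content R) fair_coin_content_sigma_subadditive.

(* The product, over all coordinates, of the uniform probability measure on
   [bool]; it is characterized by [cantor_measure_cylinder] below. *)
Definition cantor_measure :
    set (g_sigma_algebraType (@measurable _ cylinder_type)) -> \bar R :=
  measure_extension (@fair_coin_content R).

HB.instance Definition _ := Measure.on cantor_measure.

Lemma cantor_measureE n A :
  determined n A -> cantor_measure A = (word_ratio R n A)%:E.
Proof.
move=> dA; rewrite -(fair_coin_contentE R dA).
by rewrite /cantor_measure /measure_extension measurable_mu_extE//; exists n.
Qed.

Lemma word_ratio_cylinder n (s : cantor_space) :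
  word_ratio R n [set x | forall i, (i < n)%N -> x i = s i] = 2 ^- n.
Proof.
have word_ratio0 m : word_ratio R m set0 = 0.
  elim: m => [|m IHm] /=; first by case: asboolP.
  by rewrite !preimage_set0 IHm addr0 mul0r.
elim: n s => [|n IHn] s /=; first by case: asboolP => [_|[]//]; rewrite expr0 invr1.
have Es b : ccons b @^-1` [set x | forall i, (i < n.+1)%N -> x i = s i] =
    if b == s 0%N then [set x | forall i, (i < n)%N -> x i = s i.+1] else set0.
  apply/seteqP; split=> x /=.
    move=> H; case: eqP => [_ i|]; first by move/(H i.+1).
    by have /= := H 0%N isT.
  by case: eqP => // -> H [|i]//= /H.
rewrite !Es exprSr invfM; case: (s 0%N) => /=;
  by rewrite word_ratio0 ?addr0 ?add0r (IHn (fun i => s i.+1)).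
Qed.

Lemma cantor_measure_cylinder n (s : cantor_space) :
  cantor_measure [set x | forall i, (i < n)%N -> x i = s i] = (2 ^- n)%:E.
Proof.
rewrite -(word_ratio_cylinder n s); apply: cantor_measureE => x y xy /= xs i ni.
by rewrite -xy// xs.
Qed.

Lemma cantor_measure_setT : cantor_measure setT = 1%E.
Proof.
rewrite (@cantor_measureE 0%N)//=; by case: asboolP => // -[].
Qed.

HB.instance Definition _ :=
  Measure_isProbability.Build _ _ _ cantor_measure cantor_measure_setT.

End cantor_measure.

Lemma cantor_closed_measurable (K : set cantor_space) :
  closed K ->
  measurable (K : set (g_sigma_algebraType (@measurable _ cylinder_type))).
Proof.
move=> cK.
pose Kn n : set cantor_space :=
  [set x | exists2 y, K y & forall i, (i < n)%N -> x i = y i].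
have KE : K = \bigcap_n Kn n.
  apply/seteqP; split=> [x Kx n _|x Kx]; first by exists x.
  pose y n : cantor_space := sval (cid2 (Kx n I)).
  have Ky n : K (y n) by rewrite /y; case: cid2.
  have xy n i : (i < n)%N -> x i = y n i by rewrite /y; case: cid2 => ? ? H /H.
  apply: (@closed_cvg _ cantor_space \oo _ y K cK); first exact: nearW.
  apply/cvg_sup => i.
  have surj : (fun z : nat -> bool => z i) @` setT = setT.
    by rewrite eqEsubset; split => // b _; exists (fun=> b).
  apply/cvg_image => //; apply/discrete_cvg; first exact: filter_image.
  exists [set z : nat -> bool | z i = x i].
    by exists i.+1 => // n /= /xy.
  by apply/seteqP; split=> b; [case=> z /= zx <-|move=> /= ->; exists x].
rewrite KE; apply: (@bigcapT_measurable _
  (g_sigma_algebraType (@measurable _ cylinder_type)) Kn) => n.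
apply: sub_sigma_algebra; exists n => x z xz [y Ky xy]; exists y => // i ni.
by rewrite -xz// xy.
Qed.

Definition measure_zero_ultrafilter (R : realType) (u : set_system nat) : Prop :=
  UltraFilter u /\
  forall F : nat -> cantor_space,
    exists2 A, u A & cantor_measure R (closure (F @` A)) = 0%E.

Definition ultrafilter_sum (u : set_system nat) (v : nat -> set_system nat) :
    set_system (nat * nat) :=
  [set Z | u [set n | v n [set m | Z (n, m)]]].

(* Main.v *)
Require Import Defs.
From mathcomp Require Import all_boot all_order all_algebra.
From mathcomp Require Import all_classical all_reals all_analysis.

Local Open Scope classical_set_scope.

(** For each [n] let [x n] be the limit of [F (n, -)] along [v n], and choose
    [A] in [u] such that [closure (x @` A)] is null. Shrink a set of [v n] whose
    image under [F (n, -)] has null closure so that this image moreover lies in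
    the cylinder of length [n] around [x n]. Because these cylinders shrink, a
    limit point of the union of the images over [n] in [A] which is in none of
    their closures is a limit point of [x @` A]; the closure of the union is
    thus covered by countably many null sets. *)

(** For sums and images this dichotomy is easier to check than maximality, which follows since no
    proper filter contains both [A] and its complement. *)
Lemma ultrafilterP T (F : set_system T) : ProperFilter F ->
  (forall A, F A \/ F (~` A)) -> UltraFilter F.
Proof.
move=> FF FC; split => // G GF FG; rewrite eqEsubset; split => // A GA.
have [//|/FG GnA] := FC A.
have /filter_ex[? []//] : G (A `&` ~` A) by exact: filterI.
Qed.

Lemma ultrafilter_sum_ultra (u : set_system nat) (v : nat -> set_system nat) :
  UltraFilter u -> (forall n, UltraFilter (v n)) ->
  UltraFilter (ultrafilter_sum u v).
Proof.
move=> uU vU; apply: ultrafilterP => [|Z].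
  split.
    rewrite /ultrafilter_sum /= => /filter_ex[n /=].
    exact: filter_not_empty.
  split.
  - by apply: (@filterE _ u) => n; exact: (@filterT _ (v n)).
  - move=> P Q uP uQ; apply: (@filterS _ u _ _ _ _ (@filterI _ u _ _ _ uP uQ)) => n [] /=.
    exact: (@filterI _ (v n)).
  - move=> P Q PQ; apply: (@filterS _ u) => n /=.
    by apply: (@filterS _ (v n)) => m /=; exact: PQ.
(* The dichotomy is applied twice: in [u] to the set of indices with a large section, then in each
   [v n] to the section itself. *)
have [|uC] := in_ultra_setVsetC [set n | v n [set m | Z (n, m)]] uU; first by left.
right; apply: filterS uC => n /= vn.
by have [|] := in_ultra_setVsetC [set m | Z (n, m)] (vU n).
Qed.

Lemma fmap_ultra T U (f : T -> U) (F : set_system T) :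
  UltraFilter F -> UltraFilter (fmap f F).
Proof.
move=> FU; apply: ultrafilterP => A.
exact: (in_ultra_setVsetC (f @^-1` A) FU).
Qed.

Lemma cantor_closureP (E : set cantor_space) (x : cantor_space) :
  closure E x <->
  forall n, exists2 y, E y & forall i, (i < n)%N -> x i = y i.
Proof.
split=> [Ex n|Ex]; first by have [y [Ey xy]] := Ex _ (near_agree x n); exists y.
pose y n : cantor_space := sval (cid2 (Ex n)).
have Ey n : closure E (y n).
  by rewrite /y; case: cid2 => z Ez ? /=; exact: subset_closure.
have xy n i : (i < n)%N -> x i = y n i by rewrite /y; case: cid2 => ? ? H /H.
apply: (@closed_cvg _ cantor_space \oo _ y _ (@closed_closure _ E)).
  exact: nearW.
(* Convergence in the product is coordinatewise, and coordinate [i] of [y n] is constant from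
   [n = i.+1] on. *)
apply/cvg_sup => i.
have surj : (fun z : nat -> bool => z i) @` setT = setT.
  by rewrite eqEsubset; split => // b _; exists (fun=> b).
apply/cvg_image => //; apply/discrete_cvg; first exact: filter_image.
exists [set z : nat -> bool | z i = x i].
  by exists i.+1 => // n /= /xy.
by apply/seteqP; split=> b; [case=> z /= zx <-|move=> /= ->; exists x].
Qed.

(** The ultrafilter decides each bit of the limit; finitely many decisions hold together on a set of
    [F]. *)
Lemma cantor_ultra_lim T (F : set_system T) (f : T -> cantor_space) :
  UltraFilter F -> exists x : cantor_space,
  forall n, F [set t | forall i, (i < n)%N -> x i = f t i].
Proof.
move=> FU; exists (fun i => `[< F [set t | f t i] >]).
elim=> [|n IHn]; first exact: filterE.
have Fn : F [set t | `[< F [set t | f t n] >] = f t n].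
  case: asboolP => [|nF]; first by apply: filterS => t /= ->.
  have [//|] := in_ultra_setVsetC [set t | f t n] FU.
  by apply: filterS => t /= /negP/negbTE ->.
apply: filterS (filterI IHn Fn) => t [/= tn tE] i.
by rewrite ltnS leq_eqVlt => /predU1P[->|/tn].
Qed.

Lemma cantor_null_cover (R : realType) (K : set cantor_space)
    (L : nat -> set cantor_space) :
  closed K -> (forall n, closed (L n)) ->
  (forall n, cantor_measure R (L n) = 0%E) ->
  K `<=` \bigcup_n L n -> cantor_measure R K = 0%E.
Proof.
move=> cK cL L0 KL.
apply: (measure_negligible (mu := cantor_measure R)).
  exact: cantor_closed_measurable.
apply: (negligibleS (mu := cantor_measure R) KL); apply: negligible_bigcup => n.
exists (L n); split=> //; last exact: L0.
exact: (cantor_closed_measurable (cL n)).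
Qed.

Lemma closure_bigcup_near (A : set nat) (x : nat -> cantor_space)
    (G : nat -> set cantor_space) :
  (forall n y, G n y -> forall i, (i < n)%N -> x n i = y i) ->
  closure (\bigcup_(n in A) G n) `<=`
    closure (x @` A) `|` \bigcup_n closure (G n).
Proof.
move=> Gx y Gy; have [?|nxy] := pselect (closure (x @` A) y); [by left|right].
have [N xN] : exists N, forall n, A n ->
    ~ forall i, (i < N)%N -> y i = x n i.
  apply: contrapT => nN; apply: nxy; apply/cantor_closureP => N.
  apply: contrapT => yN; apply: nN; exists N => n An yx.
  by apply: yN; exists (x n) => //; exists n.
have cG : closed (\bigcup_(n in `I_N) closure (G n)).
  by apply: closed_bigcup => // n _; exact: closed_closure.
(* Only indices below [N] matter near [y], and a finite union of closed sets is closed. *)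
suff : closure (\bigcup_(n in `I_N) closure (G n)) y.
  by move/cG => [n _ Gy']; exists n.
apply/cantor_closureP => k.
(* Agreement up to [k] gives the approximation; agreement up to [N] forces [n < N], since otherwise
   [x n] would agree with [z], hence with [y], up to [N]. *)
move/cantor_closureP/(_ (maxn k N)): Gy => [z [n An Gz] yz].
exists z => [|i ik]; last by apply: yz; rewrite leq_max ik.
exists n; last exact: subset_closure.
rewrite /= ltnNge; apply/negP => Nn; apply: (xN n An) => i iN.
rewrite (Gx n z Gz) ?(leq_trans iN Nn)//.
by apply: yz; rewrite leq_max iN orbT.
Qed.

Theorem theorem2p5 (R : realType) (u : set_system nat)
    (v : nat -> set_system nat) :
  measure_zero_ultrafilter R u ->
  (forall n, measure_zero_ultrafilter R (v n)) ->
  forall e : nat * nat -> nat, bijective e ->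
  measure_zero_ultrafilter R (fmap e (ultrafilter_sum u v)).
Proof.
move=> [uU u0] v0 e _.
have vU n : UltraFilter (v n) by have [] := v0 n.
split; first exact/fmap_ultra/ultrafilter_sum_ultra.
move=> F.
have /choice[x xlim] := fun n =>
  cantor_ultra_lim _ (v n) (fun m => F (e (n, m))) (vU n).
have /choice[B HB] : forall n, exists B, v n B /\
    cantor_measure R (closure ((fun m => F (e (n, m))) @` B)) = 0%E.
  by move=> n; have [_ /(_ (fun m => F (e (n, m))))[B]] := v0 n; exists B.
have [A uA A0] := u0 x.
pose C n := B n `&` [set m | forall i, (i < n)%N -> x n i = F (e (n, m)) i].
pose Z := [set p : nat * nat | A p.1 /\ C p.1 p.2].
pose G n := [set F (e (n, m)) | m in C n].
exists (e @` Z).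
  rewrite /fmap /= /ultrafilter_sum /=; apply: filterS uA => n An /=.
  have vC : v n (C n) by apply: filterI; [have [] := HB n|exact: xlim].
  by apply: filterS vC => m Cm; exists (n, m).
have -> : F @` (e @` Z) = \bigcup_(n in A) G n.
  apply/seteqP; split=> [_ [_ [[n m] [/= An Cm] <-] <-]|_ [n An [m Cm <-]]].
    by exists n => //; exists m.
  by exists (e (n, m)) => //; exists (n, m).
(* Index 0 holds the closure of the limits, so the others are shifted by one. They use [B k], whose
   image is known to have null closure, in place of its subset [C k]. *)
pose L n := if n is k.+1
  then closure ((fun m => F (e (k, m))) @` B k) else closure (x @` A).
apply: (@cantor_null_cover R _ L).
- exact: closed_closure.
- by case=> [|n]; exact: closed_closure.
- by case=> [|n] //; have [] := HB n.
move=> y /(closure_bigcup_near A x)[n _ [m [_ Cm] <-]//|xy|[n _ Gy]].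
  by exists 0%N.
exists n.+1 => //; apply: closureS Gy.
by move=> _ [m [Bm _] <-]; exists m.
Qed.
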